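(* Let $W$ be a finite Coxeter group with set of simple reflections $S$, let $J\subset S$, and let $\underline s=(s_1,\ldots,s_n)$ be a sequence of simple reflections. Then $$c'_J(\underline s)=c_J(\underline s),$$ where $$c'_J(\underline s)=\sum_{w\in W}\ \sum_{\underline b\in\mathrm{Good}(\underline s,J,w)}q^{|\underline b|}$$ and $c_J(\underline s)=\mathrm{Tr}\big((-)\cdot_J(1+T_{s_1})(1+T_{s_2})\cdots(1+T_{s_n})\big)$ is the trace of the indicated operator on $V_J$ (equivalently, the value of the induced character $\chi^{i_{W_J}^W}$ on $(1+T_{s_1})\cdots(1+T_{s_n})$).
   Context: $\ell$ is the length function of $W$; $\max,\min$ below are with respect to the Bruhat order. $W_J=\langle J\rangle$ and ${}^JW$ is the set of minimal length representatives of the cosets $W_J\backslash W$. For $w\in{}^JW$, $s\in S$, put $w\cdot_Js=ws$ if $ws\in{}^JW$, and $w\cdot_Js=w$ otherwise. **Hecke algebra and the module $V_J$.** $H_W$ is the $\mathbb{C}(q^{1/2})$-algebra with basis $\{T_w\}_{w\in W}$, $T_uT_w=T_{uw}$ if $\ell(uw)=\ell(u)+\ell(w)$, $T_s^2=(q-1)T_s+q$ for $s\in S$. $H_W$ acts on the right on $V_J=\bigoplus_{w\in{}^JW}\mathbb{C}(q^{1/2})w$ by $$w\cdot_JT_s=q\max(w\cdot_Js,w)+\min(w\cdot_Js,w)-w .$$ $\chi^{i_{W_J}^W}$ is the character of the $H_W$-module induced from the one-dimensional $H_{W_J}$-module with $T_s\mapsto q$. **The maps $\phi$.** For $s\in S$,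 $b\in\{0,1\}$ define $\phi_{s,b}:W\to W$ by $\phi_{s,1}(w)=\max(ws,w)$, $\phi_{s,0}(w)=\min(ws,w)$. For $\underline b=(b_1,\ldots,b_n)\in\{0,1\}^n$ let $\phi_{\underline s,\underline b}=\phi_{s_n,b_n}\circ\cdots\circ\phi_{s_1,b_1}$. Write $\underline s|_i=(s_1,\ldots,s_i)$, $\underline b|_i=(b_1,\ldots,b_i)$, so $\phi_{\underline s|_0,\underline b|_0}=\mathrm{id}$. $|\underline b|=\sum_ib_i$. **Good words.** $D_L(w)=\{s\in S:\ell(sw)<\ell(w)\}$ is the set of left descents. A word $\underline b\in\{0,1\}^n$ is $(\underline s,J)$-good for $w\in W$ if (i) $\phi_{\underline s,\underline b}(w)=w$, and (ii) for each $s\in D_L(w)\cap J$ there exists $i\in\{1,\ldots,n\}$ such that $\phi_{\underline s|_{i-1},\underline b|_{i-1}}(w)\,s_i=s\,\phi_{\underline s|_{i-1},\underline b|_{i-1}}(w)$. $\mathrm{Good}(\underline s,J,w)$ is the set of all such words. *)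

(* Defs.v *)
From HB Require Import structures.
From mathcomp Require Import all_boot all_order all_algebra all_fingroup.
From mathcomp Require Import fraction complex reals.

Set Implicit Arguments.
Unset Strict Implicit.
Unset Printing Implicit Defensive.

Import GRing.Theory.

Section Coxeter.

Local Open Scope group_scope.

Variable W : finGroupType.
Implicit Types (S J : {set W}) (s t u v w x y : W).

(* The last clause is the universal property of the presentation
   < S | (s t)^m(s,t) = 1 for s, t in S > with m(s,t) the order of s t in W
   (so m(s,s) = 1); the target G is an arbitrary, possibly infinite, group. *)
Definition coxeter_system S : Prop :=
  [/\ <<S>> = [set: W],
      forall s, s \in S -> #[s] = 2%N
    & forall (G : groupType) (f : W -> G),
        (forall s t, s \in S -> t \in S -> (f s * f t) ^+ #[s * t] = 1) ->
        exists phi : {multiplicative W -> G}, {in S, forall s, phi s = f s}].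

(* S ^+ n is the set of all products of n elements of S. When S generates W,
   every element has a shortest expression with fewer than #|W| letters, so
   the search bound plays no role. *)
Definition len S w : nat := find (fun n => w \in S ^+ n) (iota 0 #|W|).

Definition reflections S : {set W} := [set s ^ x | s in S, x in [set: W]].

Definition bruhat S : rel W :=
  connect (fun u v => [exists t in reflections S,
                         (v == u * t) && (len S u < len S v)%N]).

(* Only meaningful for Bruhat-comparable u and v. *)
Definition bmax S u v : W := if bruhat S u v then v else u.
Definition bmin S u v : W := if bruhat S u v then u else v.

(* The minimal length representatives of the cosets W_J w. *)
Definition minrep S J : {set W} :=
  [set w | [forall x in <<J>>, (len S w <= len S (x * w))%N]].

Definition dotJ S J w s : W :=
  if w * s \in minrep S J then w * s else w.

Definition phi1 S s (b : bool) w : W :=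
  if b then bmax S (w * s) w else bmin S (w * s) w.

Definition phi S (ss : seq W) (bs : seq bool) w : W :=
  foldl (fun x p => phi1 S p.1 p.2 x) w (zip ss bs).

Definition left_descents S w : {set W} :=
  [set s in S | (len S (s * w) < len S w)%N].

(* The index i : 'I_n is the i of the definition of good words shifted by 1. *)
Definition Good S J n (ss : n.-tuple W) w : {set n.-tuple bool} :=
  [set b : n.-tuple bool |
     (phi S ss b w == w) &&
     [forall s in left_descents S w :&: J, [exists i : 'I_n,
        phi S (take i ss) (take i b) w * tnth ss i
          == s * phi S (take i ss) (take i b) w]]].

End Coxeter.

Local Open Scope ring_scope.

(* The field C(q^(1/2)): rational functions over the complex numbers R[i] in
   the indeterminate q^(1/2). *)
Definition Kq (R : realType) : fieldType := {fraction {poly R[i]}}.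

Definition qhalf (R : realType) : Kq R := tofrac ('X : {poly R[i]}).

Definition q (R : realType) : Kq R := qhalf R ^+ 2.

Arguments q {R}.

Section Hecke.

Variables (R : realType) (W : finGroupType).
Implicit Types (S J : {set W}).

Local Notation K := (Kq R).

Definition hecke_algebra S (H : algType K) (T : W -> H) : Prop :=
  [/\ forall h : H, exists! c : {ffun W -> K}, h = \sum_w c w *: T w,
      forall u w : W, len S (u * w)%g = (len S u + len S w)%N ->
        T u * T w = T (u * w)%g
    & forall s, s \in S -> T s * T s = (q - 1) *: T s + q%:A].

(* V_J is the space of row vectors indexed by the minimal coset
   representatives; the i-th coordinate belongs to enum_val i. Matrices act on
   it on the right. *)
Definition VJ S J := 'rV[K]_#|minrep S J|.

Definition VJ_basis S J (w : W) : VJ S J :=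
  \row_i (enum_val i == w)%:R.

Definition VJ_T S J (s : W) : 'M[K]_#|minrep S J| :=
  \matrix_(i < #|minrep S J|)
    let w := enum_val i in
    q *: VJ_basis S J (bmax S (dotJ S J w s) w)
      + VJ_basis S J (bmin S (dotJ S J w s) w) - VJ_basis S J w.

(* v *m rho h is the right action of h on the vector v of V_J. *)
Definition VJ_module S J (H : algType K) (T : W -> H)
    (rho : {linear H -> 'M[K]_#|minrep S J|}) : Prop :=
  [/\ rho 1 = 1%:M,
      forall a b : H, rho (a * b) = rho a *m rho b
    & forall s, s \in S -> rho (T s) = VJ_T S J s].

Definition cJ S J n (ss : n.-tuple W) : K :=
  \tr (\prod_(s <- ss) (1%:M + VJ_T S J s)).

Definition cJ' S J n (ss : n.-tuple W) : K :=
  \sum_(w : W) \sum_(b in Good S J ss w) q ^+ (\sum_(i < n) tnth b i)%N.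

End Hecke.

(* Main.v *)
Require Import Defs.
From HB Require Import structures.
From mathcomp Require Import all_boot all_order all_algebra all_fingroup.
From mathcomp Require Import fraction complex reals.

Set Implicit Arguments.
Unset Strict Implicit.
Unset Printing Implicit Defensive.

(** Fix the bits [b] and let [F] be the composite map [phi] on [W].  Both sides
    of the identity are sums over [b] of [q^|b|] times a cardinality.  On the
    trace side, [1 + T_s] maps a basis vector [w] to [q max + min], so the
    product expands into one basis vector for each [b], and the cardinality is
    the number of minimal representatives fixed by the analogue [phiJ] of [phi]
    ([cJ_fixpoints]).  On the other side it is the number of [w] for which [b]
    is good.  So it suffices to see that each coset of [W_J] fixed by [phiJ]
    contains exactly one such [w], and that the other cosets contain none
    ([card_Good]).

    The main point is what happens to a pair [y < s y] with [s] in [J] when both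
    are moved by [phi]: as long as [s y t <> y], the two elements move in
    parallel and remain related by left multiplication by [s]; at the first step
    with [s y t = y], which is the step required by goodness for the element
    [s y] and its descent [s], they merge ([phi_meets]).  Two things follow.

    First, [F] is monotone for the left weak order on the coset and does not
    stretch chains.  The coset has a least element, its minimal representative,
    and [F] maps the coset to itself, hence by a Knaster-Tarski argument [F] has
    a least fixed point [u] in the coset.

    Second, a fixed point [w] is good if and only if [F (s w) = w] for every
    descent [s] of [w] in [J]; otherwise [s w] is fixed ([Good_merge]).  The
    least fixed point is therefore good.  Any other fixed point [w] has a
    descent [s] with [u <= s w]; since [F] does not increase lengths above [u],
    [F (s w)] is shorter than [w], and [w] is not good ([good_unique]).

    All facts on lengths come from the exchange property, which is derived from
    the presentation of [W] with signed permutations: the length of [s w] is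
    smaller than that of [w] exactly when a cocycle [eta w s] takes the value
    true ([eta_len]).  The cocycle identity gives at once the dichotomy above
    ([len_square]) and Deodhar's lemma ([minrep_Smul]), and its evaluation on
    words gives the structure of the cosets of [W_J] ([minrep_descent]). *)

(** * Words *)

Section Products.

Local Open Scope group_scope.
Variables (W : finGroupType) (A : {set W}).
Implicit Types (s v w : W) (r : seq W).

Local Notation "\W r" := (\prod_(a <- r) a) (at level 10, r at level 8).

Lemma prodW_cons s r : \W (s :: r) = s * \W r.
Proof. by rewrite big_cons. Qed.

Lemma prodW_cat r1 r2 : \W (r1 ++ r2) = \W r1 * \W r2.
Proof. by rewrite big_cat. Qed.

Lemma mem_expg_word n w :
  reflect (exists r, [/\ all (mem A) r, size r = n & \W r = w]) (w \in A ^+ n).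
Proof.
apply: (iffP idP) => [|[r [wr <- <-]]]; last first.
  elim: r wr => [|s r IH] /=; first by rewrite big_nil expg0 inE.
  by case/andP=> sA /IH wr; rewrite expgS big_cons mem_mulg.
elim: n w => [|n IH] w.
  by rewrite expg0 => /set1P->; exists [::]; rewrite big_nil.
rewrite expgS => /mulsgP[s v sA /IH[r [wr sr <-]] ->].
by exists (s :: r); rewrite /= sA wr sr prodW_cons.
Qed.

Lemma gen_word w : w \in <<A>> -> exists n, w \in A ^+ n.
Proof.
case/gen_prodgP=> n [c cA ->]; exists n.
elim: n c cA => [|n IH] c cA; first by rewrite big_ord0 inE.
rewrite big_ord_recl expgS mem_mulg //; exact: IH.
Qed.

Lemma cat_cons_split r1 a r2 t r : r1 ++ a :: r2 = t ++ r ->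
  (exists c, t = r1 ++ a :: c /\ r2 = c ++ r)
  \/ (exists c, r1 = t ++ c /\ r = c ++ a :: r2).
Proof.
elim: t r1 => [|b t IH] [|d r1] /=; first by right; exists [::].
- by move=> e; right; exists (d :: r1).
- by case=> -> ->; left; exists t.
by case=> -> /IH[[c [-> ->]]|[c [-> ->]]]; [left|right]; exists c.
Qed.

End Products.

Section Words.

Local Open Scope group_scope.
Variables (W : finGroupType) (S : {set W}).
Hypothesis hS : coxeter_system S.
Implicit Types (s t u v w x y : W) (r : seq W).

Local Notation ell := (len S).
Local Notation word r := (all (mem S) r).
Local Notation "\W r" := (\prod_(a <- r) a) (at level 10, r at level 8).

Lemma mulSS s : s \in S -> s * s = 1.
Proof.
case: hS => _ ord2 _ /ord2 o2.
by rewrite -expg2 -o2 expg_order.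
Qed.

Lemma mulSK s x : s \in S -> s * (s * x) = x.
Proof. by move=> sS; rewrite mulgA mulSS // mul1g. Qed.

Lemma mulKS s x : s \in S -> x * s * s = x.
Proof. by move=> sS; rewrite -mulgA mulSS // mulg1. Qed.

Lemma invS s : s \in S -> s^-1 = s.
Proof. by move=> sS; apply: (mulgI s); rewrite mulgV mulSS. Qed.

(** Generation gives some expression of [w]; erasing the loops of the
    corresponding walk in the Cayley graph makes it shorter than [#|W|], which
    is what the search performed by [len] requires. *)
Lemma len_word w : exists r, [/\ word r, size r = ell w & \W r = w].
Proof.
pose e : rel W := fun u v => u^-1 * v \in S.
have step u s : s \in S -> e u (u * s) by move=> sS; rewrite /e mulKg.
have e_conn : connect e 1 w.
  have: w \in <<S>> by case: hS => -> _ _; rewrite inE.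
  case/gen_word=> n /mem_expg_word[r [wr _ <-]].
  elim/last_ind: r wr => [|r s IH]; first by rewrite big_nil.
  rewrite all_rcons -cats1 prodW_cat big_seq1 => /andP[sS /IH r_conn].
  by apply: connect_trans r_conn (connect1 (step _ _ sS)).
have [n nW wn] : exists2 n, (n < #|W|)%N & w \in S ^+ n.
  case/connectP: e_conn => p pp ->.
  case/shortenP: pp => {}p pp up _.
  exists (size p).
    by have := max_card (mem (1 :: p)); rewrite (card_uniqP up).
  suff: forall u, path e u p -> u^-1 * last u p \in S ^+ size p.
    by move/(_ _ pp); rewrite invg1 mul1g.
  elim: p {up pp} => [|v p IH] u /=; first by rewrite mulVg expg0 inE.
  case/andP=> uv /IH pv.
  by rewrite expgS -[last v p](mulKVg v) mulgA mem_mulg.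
apply/mem_expg_word.
have w_found: has (fun m => w \in S ^+ m) (iota 0 #|W|).
  by apply/hasP; exists n => //; rewrite mem_iota.
have := nth_find 0 w_found.
by rewrite nth_iota // -[X in (_ < X)%N](size_iota 0) -has_find.
Qed.

Lemma len_prodW r : word r -> (ell (\W r) <= size r)%N.
Proof.
move=> wr; rewrite leqNgt; apply/negP => lt_r.
have := before_find 0 lt_r.
have szr: (size r < #|W|)%N.
  by apply: leq_trans lt_r _; rewrite -[X in (_ <= X)%N](size_iota 0) find_size.
rewrite nth_iota // add0n => /negP; apply.
by apply/mem_expg_word; exists r.
Qed.

Lemma len_mulS s w : s \in S -> (ell (s * w) <= (ell w).+1)%N.
Proof.
move=> sS; have [r [wr <- <-]] := len_word w.
by rewrite -prodW_cons (leq_trans (len_prodW _)) //= sS.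
Qed.

Lemma prodW_rev r : word r -> \W (rev r) = (\W r)^-1.
Proof.
elim: r => [|s r IH] /=; first by rewrite !big_nil invg1.
case/andP=> sS wr; rewrite rev_cons -cats1 prodW_cat IH // big_seq1 big_cons.
by rewrite invMg (invS sS).
Qed.

Lemma lenV w : ell w^-1 = ell w.
Proof.
suff le u : (ell u^-1 <= ell u)%N by apply/eqP; rewrite eqn_leq le -{1}[w]invgK le.
have [r [wr <- <-]] := len_word u.
by rewrite -prodW_rev // -size_rev len_prodW // all_rev.
Qed.

(** * Signed permutations and the exchange property *)

(** The signed permutation of Tits' proof of the exchange property, usually
    restricted to the reflections; on all of [W] the same formula is injective
    for every [s]. *)
Definition flip s (p : W * bool) := (p.1 ^ s, p.2 (+) (p.1 == s)).

Lemma flip_inj s : injective (flip s).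
Proof.
move=> [x a] [y b] [] /conjg_inj <- /=.
by move/(congr1 (addb^~ (x == s))); rewrite !addbK => ->.
Qed.

Definition flip_perm s : {perm W * bool} := perm (@flip_inj s).

Lemma flip_permE s x b : flip_perm s (x, b) = (x ^ s, b (+) (x == s)).
Proof. by rewrite permE. Qed.

(** After [i] rounds [x] has been conjugated to [s] exactly when
    [x = (s t)^(2i) s], and half a round later to [t] exactly when
    [x = (s t)^(2i+1) s]; these are the moments at which its sign flips. *)
Lemma flip_perm_expg s t k x b : s \in S -> t \in S ->
  ((flip_perm s * flip_perm t) ^+ k) (x, b) =
    (x ^ ((s * t) ^+ k),
     b (+) odd (\sum_(j < k.*2) (x == (s * t) ^+ j * s)%g)).
Proof.
move=> sS tS; elim: k => [|k IH].
  by rewrite !expg0 perm1 big_ord0 conjg1 addbF.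
have conj_st j : s * (s * t) ^- j = (s * t) ^+ j * s.
  elim: j => [|j IHj]; first by rewrite expg0 invg1 mulg1 mul1g.
  rewrite [in LHS]expgSr [in RHS]expgS !invMg (invS sS) (invS tS) !mulgA.
  by rewrite -[_ * (_ ^- j)]mulgA IHj mulgA.
have eq_conj y z : (x ^ y == z) = (x == z ^ y^-1).
  by rewrite -[in LHS](conjgKV y z) (inj_eq (@conjg_inj _ y)).
rewrite expgSr permM IH permM !flip_permE -!conjgM expgSr mulgA; congr (_, _).
rewrite doubleS !big_ord_recr /= !oddD !oddb !addbA; congr (_ (+) _ (+) _).
  by rewrite eq_conj conjgE invgK conj_st mulgA -addnn expgD.
rewrite eq_conj conjgE invgK invMg (invS sS) conj_st.
by rewrite -addnn -addnS expgD expgS !mulgA.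
Qed.

(** With [m] the order of [s t], the elements [(s t)^j s] for [j < 2m] run twice
    through the same list, so that all sign flips cancel. *)
Lemma flip_perm_rel s t : s \in S -> t \in S ->
  (flip_perm s * flip_perm t) ^+ #[s * t] = 1.
Proof.
move=> sS tS; apply/permP=> -[x b]; rewrite flip_perm_expg // expg_order conjg1.
rewrite perm1 -addnn big_split_ord /=; congr (_, _).
under [X in (_ + X)%N]eq_bigr => i _ do rewrite expgD expg_order mul1g.
by rewrite oddD addbb addbF.
Qed.

(** This is where the presentation of [W] enters: by [flip_perm_rel] the
    signed permutations extend to an action of [W], and [eta w x] records
    whether [w] changes the sign of [x]. *)
Lemma sign_cocycle : exists eta : W -> W -> bool,
  (forall u w x, eta (u * w) x = eta u x (+) eta w (x ^ u)) /\
  (forall s x, s \in S -> eta s x = (x == s)).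
Proof.
have [genS _ univ] := hS.
have [f fS] := univ _ flip_perm flip_perm_rel.
have f1: f 1 = 1 by apply: (mulgI (f 1)); rewrite -gmulfM !mulg1.
have fE w x b : f w (x, b) = (x ^ w, b (+) (f w (x, false)).2).
  have [r [wr _ <-]] := len_word w.
  elim: r wr x b => [|s r IH] /= wr x b.
    by rewrite big_nil f1 !perm1 conjg1 addbF.
  case/andP: wr => sS wr; rewrite big_cons gmulfM !permM (fS s sS) !flip_permE.
  by rewrite IH // [in RHS]IH //= -conjgM addbA.
exists (fun w x => (f w (x, false)).2); split=> [u w x|s x sS].
  by rewrite gmulfM permM fE [in LHS]fE.
by rewrite fS // flip_permE.
Qed.

Section Cocycle.

Variable eta : W -> W -> bool.
Hypothesis etaM : forall u w x, eta (u * w) x = eta u x (+) eta w (x ^ u).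
Hypothesis etaS : forall s x, s \in S -> eta s x = (x == s).

Lemma eta1 x : eta 1 x = false.
Proof. by have := etaM 1 1 x; rewrite mulg1 conjg1; case: (eta 1 x). Qed.

(** A sign change along a word is caused by one of its letters [t]; conjugating
    back by the prefix [p] before it gives [x = p t p^-1], so that multiplying
    by [x] deletes this letter. *)
Lemma eta_letter r x : word r -> eta (\W r) x ->
  exists r1 t r2, r = r1 ++ t :: r2 /\ x * \W r = \W (r1 ++ r2).
Proof.
elim: r x => [|s r IH] x /=; first by rewrite big_nil eta1.
case/andP=> sS wr; rewrite big_cons etaM etaS //.
have [-> _|_ /=] := eqVneq x s.
  by exists [::], s, r; rewrite mulSK.
case/(IH _ wr) => r1 [t [r2 [-> e]]].
exists (s :: r1), t, r2; split=> //=.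
by rewrite big_cons -e /conjg invS // !mulgA mulSS // mul1g.
Qed.

(** A sign change of [s] makes [w] shorter by deletion of a letter.  Conversely
    [eta (s w) s] and [eta w s] are opposite, so if [w] does not change the sign
    of [s] then [s w] does, and [w = s (s w)] is the shorter one. *)
Lemma eta_len s w : s \in S -> (ell (s * w) < ell w)%N = eta w s.
Proof.
move=> sS.
have down v : eta v s -> (ell (s * v) < ell v)%N.
  have [r [wr szr def_v]] := len_word v; rewrite -szr -def_v.
  case/(eta_letter wr)=> r1 [t [r2 [def_r ->]]].
  move: wr; rewrite def_r all_cat /= => /and3P[w1 _ w2].
  apply: (@leq_ltn_trans (size (r1 ++ r2))).
    by rewrite len_prodW // all_cat w1.
  by rewrite !size_cat /= addnS.
case: (boolP (eta w s)) => [/down-> //|ew].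
have /down: eta (s * w) s by rewrite etaM etaS // eqxx conjgE mulKg (negPf ew).
by rewrite mulSK // => /ltnW; rewrite ltnNge => ->.
Qed.

End Cocycle.

Lemma len_mulS_neq s w : s \in S -> ell (s * w) != ell w.
Proof.
move=> sS; have [eta [etaM etaS]] := sign_cocycle.
have el := eta_len etaM etaS.
apply/negP => /eqP e.
have := el _ (s * w) sS; rewrite mulSK // e ltnn etaM etaS // eqxx.
by rewrite conjgE mulKg -(el _ w sS) e ltnn.
Qed.

Lemma len_Smul_neq s w : s \in S -> ell (w * s) != ell w.
Proof. by move=> sS; rewrite -lenV invMg invS // -[ell w]lenV len_mulS_neq. Qed.

(** The exchange property. *)
Lemma len_exchange s r : s \in S -> word r -> (ell (s * \W r) < ell (\W r))%N ->
  exists r1 t r2, r = r1 ++ t :: r2 /\ s * \W r = \W (r1 ++ r2).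
Proof.
have [eta [etaM etaS]] := sign_cocycle.
by move=> sS wr; rewrite (eta_len etaM etaS) //; apply: eta_letter etaM etaS _ _ wr.
Qed.

(** By the cocycle identity, [s] can only become a descent when passing from
    [y] to [y t] if the sign flip of [t] hits [s ^ y], that is [s y = y t]. *)
Lemma len_square s t y : s \in S -> t \in S -> (ell y < ell (s * y))%N ->
  s * y != y * t -> (ell (y * t) < ell (s * (y * t)))%N.
Proof.
have [eta [etaM etaS]] := sign_cocycle; have el := eta_len etaM etaS.
move=> sS tS.
have up v : (ell v < ell (s * v))%N = ~~ eta v s.
  by rewrite -el // -leqNgt ltn_neqAle eq_sym len_mulS_neq.
rewrite !up etaM (etaS t _ tS) => /negPf-> /=.
by apply: contra => /eqP <-; rewrite conjgE mulKVg.
Qed.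



Lemma len_up s y : s \in S -> (ell y < ell (s * y))%N -> ell (s * y) = (ell y).+1.
Proof. by move=> sS lt_y; apply/eqP; rewrite eqn_leq len_mulS. Qed.

(** * The maps [phi] and the left weak order *)

Lemma bruhat_len u v : bruhat S u v -> (ell u <= ell v)%N.
Proof.
case/connectP=> p; elim: p u => [|x p IH] u /=; first by move=> _ ->.
by case/andP=> /exists_inP[t _ /andP[_ /ltnW le_ux]] /IH{}IH /IH; apply: leq_trans.
Qed.

(** Only the length matters: [w s] and [w] differ by the reflection [s], so
    they are always comparable. *)
Lemma bruhat_Smul s w : s \in S -> bruhat S (w * s) w = (ell (w * s) < ell w)%N.
Proof.
move=> sS; apply/idP/idP => [/bruhat_len|lt_ws].
  by rewrite ltn_neqAle len_Smul_neq.
apply/connect1/exists_inP; exists s; last by rewrite mulKS // eqxx.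
by apply/imset2P; exists s 1; rewrite ?inE // conjg1.
Qed.

Lemma phi1E s b w : s \in S ->
  phi1 S s b w = if (ell (w * s) < ell w)%N == b then w else w * s.
Proof.
move=> sS; rewrite /phi1 /bmax /bmin bruhat_Smul //.
by case: b; case: ifP.
Qed.

(** The pair [y < s y] under right multiplication by [t]: either it is swapped
    and [phi1] sends both to the same element, or it is moved as a whole. *)
Lemma phi1_merge s t b y : s \in S -> t \in S -> (ell y < ell (s * y))%N ->
  s * y = y * t -> phi1 S t b (s * y) = phi1 S t b y.
Proof.
move=> sS tS lt_y e; rewrite !phi1E // e mulKS // -e lt_y ltnNge ltnW //=.
by case: b.
Qed.

Lemma phi1_square s t b y : s \in S -> t \in S -> (ell y < ell (s * y))%N ->
    s * y != y * t ->
  phi1 S t b (s * y) = s * phi1 S t b y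
  /\ (ell (phi1 S t b y) < ell (s * phi1 S t b y))%N.
Proof.
move=> sS tS lt_y ne; have lt_yt := len_square sS tS lt_y ne.
rewrite !phi1E // -[s * y * t]mulgA (len_up sS lt_y) (len_up sS lt_yt) ltnS.
by case: ifP.
Qed.

(** The condition that goodness imposes on a descent [s], by recursion on the
    words so as to follow the recursion of [phi]. *)
Fixpoint meets (ss : seq W) (bs : seq bool) s w : bool :=
  match ss, bs with
  | t :: ss', b :: bs' => (w * t == s * w) || meets ss' bs' s (phi1 S t b w)
  | _, _ => false
  end.

Lemma meetsP ss bs s w : size bs = size ss ->
  reflect (exists2 i, (i < size ss)%N &
     phi S (take i ss) (take i bs) w * nth 1 ss i
       == s * phi S (take i ss) (take i bs) w)
    (meets ss bs s w).
Proof.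
elim: ss bs w => [|t ss IH] [|b bs] w //=.
  by move=> _; constructor; case.
case=> sz; apply: (iffP orP) => [[e|/(IH _ _ sz)[i lt_i e]]|[[|i] lt_i e]].
- by exists 0.
- by exists i.+1.
- by left.
- by right; apply/(IH _ _ sz); exists i.
Qed.

Lemma phi_cons t b ss bs w :
  phi S (t :: ss) (b :: bs) w = phi S ss bs (phi1 S t b w).
Proof. by []. Qed.

(** Starting from [y] and [s y > y], the two trajectories stay related by left
    multiplication by [s], with the second one above the first, until a step
    at which the condition of goodness holds; they coincide from then on. *)
Lemma phi_meets s ss bs y : s \in S -> word ss -> size bs = size ss ->
    (ell y < ell (s * y))%N ->
  if meets ss bs s (s * y) then phi S ss bs (s * y) = phi S ss bs y
  else phi S ss bs (s * y) = s * phi S ss bs y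
       /\ (ell (phi S ss bs y) < ell (s * phi S ss bs y))%N.
Proof.
move=> sS; elim: ss bs y => [|t ss IH] [|b bs] y //=.
case/andP=> tS wss [sz] lt_y; rewrite !phi_cons mulSK //.
have [e|ne] := eqVneq.
  have e': s * y = y * t by rewrite -{2}e mulKS.
  by rewrite (phi1_merge b sS tS lt_y e').
have {}ne : s * y != y * t by apply: contra ne => /eqP->; rewrite mulKS.
have [-> lt_py] := phi1_square b sS tS lt_y ne.
exact: IH.
Qed.

Section Parabolic.

Variable J : {set W}.
Hypothesis hJ : J \subset S.

Let JS s : s \in J -> s \in S. Proof. exact: (subsetP hJ). Qed.

(** By [phi_meets], for [w] fixed and [s w < w] the second condition of goodness
    says that the trajectory of [s w] merges with the one of [w], and it fails
    exactly when [s w] is fixed too. *)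
Lemma Good_merge n (ss : n.-tuple W) (b : n.-tuple bool) w : word ss ->
  reflect (phi S ss b w = w /\ forall s, s \in J -> (ell (s * w) < ell w)%N ->
             phi S ss b (s * w) = w)
    (b \in Good S J ss w).
Proof.
move=> wss; have sz : size b = size ss by rewrite !size_tuple.
have meetsE s : [exists i : 'I_n, phi S (take i ss) (take i b) w * tnth ss i
          == s * phi S (take i ss) (take i b) w] = meets ss b s w.
  apply/existsP/(meetsP _ _ sz) => [[i e]|[i lt_i e]].
    by exists i; rewrite ?size_tuple // -tnth_nth.
  move: (lt_i) e; rewrite size_tuple => lt_n e.
  by exists (Ordinal lt_n); rewrite (tnth_nth 1).
rewrite inE; apply: (iffP andP) => -[/eqP fix_w good]; split=> //.
  move=> s sJ lt_sw; have sS := JS sJ.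
  have /(_ s) := forall_inP good; rewrite !inE sS lt_sw sJ meetsE => /(_ isT) m.
  have := phi_meets sS wss sz (y := s * w); rewrite mulSK // m fix_w.
  by move=> /(_ lt_sw).
apply/forall_inP=> s; rewrite !inE meetsE => /andP[/andP[sS lt_sw] sJ].
have := phi_meets sS wss sz (y := s * w); rewrite mulSK // => /(_ lt_sw).
case: ifP => // _; rewrite good // (eqP fix_w) => -[_].
by rewrite ltnNge ltnW.
Qed.

Definition stepJ : rel W :=
  fun y z => [exists s in J, (z == s * y) && (ell y < ell z)%N].
(** The left weak order inside the cosets of [<<J>>]. *)
Definition leJ : rel W := connect stepJ.

Lemma stepJP y z :
  reflect (exists s, [/\ s \in J, z = s * y & (ell y < ell z)%N]) (stepJ y z).
Proof.
by apply: (iffP exists_inP) => [[s sJ /andP[/eqP]]|[s [sJ -> lt]]]; exists s => //;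
  rewrite eqxx.
Qed.

Lemma leJ_ind (P : W -> Prop) u : P u ->
    (forall y z, leJ u y -> stepJ y z -> P y -> P z) ->
  forall w, leJ u w -> P w.
Proof.
move=> Pu Pstep w /connectP[p]; elim/last_ind: p w => [|p z IH] w /=.
  by move=> _ ->.
rewrite rcons_path last_rcons => /andP[pp st] ->.
apply: Pstep st (IH _ pp _) => //.
by apply/connectP; exists p.
Qed.

Lemma leJ_len u w : leJ u w -> (ell u <= ell w)%N.
Proof.
move: w; apply: leJ_ind => // y z _ /stepJP[s [_ _ lt_yz]] /leq_trans-> //.
exact: ltnW.
Qed.

Lemma leJ_last u w : leJ u w -> w != u ->
  exists2 s, s \in J & leJ u (s * w) /\ (ell (s * w) < ell w)%N.
Proof.
move: w; apply: leJ_ind => [|y z uy /stepJP[s [sJ -> lt_yz]] _ _].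
  by rewrite eqxx.
by exists s; rewrite // mulSK // ?JS.
Qed.

Lemma leJ_len_eq u w : leJ u w -> (ell w <= ell u)%N -> w = u.
Proof.
move=> uw le_wu; apply/eqP/negP => /negP /(leJ_last uw)[s _ [/leJ_len le_u lt_w]].
by have := leq_trans (leq_ltn_trans le_u lt_w) le_wu; rewrite ltnn.
Qed.

Lemma leJ_coset u w : leJ u w -> w * u^-1 \in <<J>>.
Proof.
move: w; apply: leJ_ind => [|y z _ /stepJP[s [sJ -> _]] yu]; first by rewrite mulgV.
by rewrite -mulgA groupM // mem_gen.
Qed.

(** * Minimal coset representatives *)

Lemma minrepP v :
  reflect (forall x, x \in <<J>> -> (ell v <= ell (x * v))%N) (v \in minrep S J).
Proof. by rewrite inE; apply: forall_inP. Qed.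

(** If multiplying [x v] on the left by the first letter of a shortest
    [J]-word for [x] did not shorten it, the exchange property would delete a
    letter either of that word, or of [v], against one of the two minimality
    assumptions. *)
Lemma minrep_descent v x : v \in minrep S J -> x \in <<J>> -> x != 1 ->
  exists2 s, s \in J & (ell (s * (x * v)) < ell (x * v))%N.
Proof.
move=> /minrepP min_v xJ x1.
case: (ex_minnP (gen_word xJ)) => n /mem_expg_word[[|s t] [wt szt def_x]] min_n.
  by rewrite -def_x big_nil eqxx in x1.
move: wt => /= /andP[sJ wt]; exists s => //.
have sS := JS sJ; have wtS : word t by apply: sub_all wt => y; apply: JS.
have [r [wr szr def_v]] := len_word v.
have def_xv : x * v = s * \W (t ++ r).
  by rewrite -def_x -def_v prodW_cons prodW_cat mulgA.
have def_tr : s * (x * v) = \W (t ++ r) by rewrite def_xv mulSK.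
rewrite ltnNge; apply/negP => le_xv.
have: (ell (s * \W (t ++ r)) < ell (\W (t ++ r)))%N.
  by rewrite -def_tr mulSK // ltn_neqAle eq_sym len_mulS_neq.
case/len_exchange => // [|r1 [a [r2 [/esym/cat_cons_split spl e]]]].
  by rewrite all_cat wtS.
have {}e : x * v = \W (r1 ++ r2) by rewrite def_xv.
case: spl => [[c [def_t def_r2]]|[c [def_r1 def_r]]].
  have ex: x = \W (r1 ++ c).
    by apply: (mulIg v); rewrite e def_r2 catA prodW_cat def_v.
  have: (n <= size (r1 ++ c))%N.
    apply: min_n; apply/mem_expg_word; exists (r1 ++ c); split=> //.
    by move: wt; rewrite def_t !all_cat /= => /and3P[-> _ ->].
  by rewrite -szt /= def_t !size_cat /= addnS leqNgt ltnW.
have ev : (\W t)^-1 * x * v = \W (c ++ r2).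
  by rewrite -mulgA e def_r1 -catA prodW_cat mulKg.
have tJ : \W t \in <<J>>.
  elim: t wt {szt def_x wtS def_xv def_tr def_r1 e ev} => [|y t IH] /=.
    by rewrite big_nil.
  by case/andP=> yJ /IH tJ; rewrite prodW_cons groupM // mem_gen.
have := min_v ((\W t)^-1 * x); rewrite groupM ?groupV // => /(_ isT).
have wcr : word (c ++ r2).
  by move: wr; rewrite def_r !all_cat /= => /and3P[-> _ ->].
rewrite ev leqNgt (leq_ltn_trans (len_prodW wcr)) // -szr def_r.
by rewrite !size_cat /= addnS.
Qed.

Lemma minrep_leJ v w : v \in minrep S J -> w * v^-1 \in <<J>> -> leJ v w.
Proof.
move=> vm; have [m] := ubnP (ell w); elim: m w => // m IH w le_w wv.
have [/eqP|ne] := eqVneq (w * v^-1) 1.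
  by rewrite -eq_mulgV1 => /eqP->; apply: connect0.
have [s sJ] := minrep_descent vm wv ne; rewrite mulgKV => lt_sw.
apply: (@connect_trans _ _ (s * w)).
  apply: IH; first exact: leq_trans lt_sw le_w.
  by rewrite -mulgA groupM // mem_gen.
by apply/connect1/stepJP; exists s; rewrite mulSK // JS.
Qed.

Lemma minrep_exists w : exists2 v, v \in minrep S J & leJ v w.
Proof.
have [x xJ min_x] := @arg_minnP _ 1 (mem <<J>>) (fun x => ell (x * w)) (group1 _).
have vm: x * w \in minrep S J.
  by apply/minrepP=> y yJ; rewrite mulgA min_x //; apply: groupM.
by exists (x * w); rewrite // minrep_leJ // invMg mulgA mulgV mul1g groupV.
Qed.

Lemma minrep_unique v v' w : v \in minrep S J -> v' \in minrep S J ->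
  leJ v w -> leJ v' w -> v = v'.
Proof.
move=> vm /minrepP v'm /leJ_coset vw /leJ_coset v'w.
have vv' : v' * v^-1 \in <<J>>.
  have -> : v' * v^-1 = (w * v'^-1)^-1 * (w * v^-1) by rewrite invMg invgK mulgA mulgKV.
  by rewrite groupM ?groupV.
apply/esym/(leJ_len_eq (minrep_leJ vm vv')).
by have := v'm (v * v'^-1); rewrite mulgKV; apply; rewrite -groupV invMg invgK.
Qed.

Lemma minrep_up v s : v \in minrep S J -> s \in J -> (ell v < ell (s * v))%N.
Proof.
move=> /minrepP min_v sJ.
by rewrite ltn_neqAle eq_sym len_mulS_neq ?JS // min_v // mem_gen.
Qed.

(** Deodhar's lemma.  Since [v s] is not minimal, some [t] in [J] is a descent of
    it but not of [v], and [len_square] leaves only one possibility. *)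
Lemma minrep_Smul v s : v \in minrep S J -> s \in S -> v * s \notin minrep S J ->
  exists2 t, t \in J & t * v = v * s.
Proof.
move=> vm sS vsm; have [u um uvs] := minrep_exists (v * s).
have [|t tJ [_ lt_t]] := leJ_last uvs; first by apply: contraNneq vsm => ->.
exists t => //; apply/eqP; apply: contraLR lt_t => ne; rewrite -leqNgt ltnW //.
exact: len_square (JS tJ) sS (minrep_up vm tJ) ne.
Qed.

(** * Fixed points of [phi] *)

Section Trajectory.

Variables (ss : seq W) (bs : seq bool).
Hypotheses (wss : word ss) (sz : size bs = size ss).
Local Notation F := (phi S ss bs).

(** So [F] is monotone for the left weak order, and maps a chain to a chain that
    is not longer. *)
Lemma phi_step y z : stepJ y z -> stepJ (F y) (F z) \/ F z = F y.
Proof.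
case/stepJP=> s [sJ -> lt_yz]; have := phi_meets (JS sJ) wss sz lt_yz.
case: ifP => _ => [->|[-> lt]]; [by right | left].
by apply/stepJP; exists s.
Qed.

Lemma leJ_phi u w : leJ u w -> leJ (F u) (F w).
Proof.
move: w; apply: leJ_ind => [|y z _ /phi_step[st|-> //] le_uy].
  exact: connect0.
exact: connect_trans le_uy (connect1 st).
Qed.

Lemma len_phi_fix u w : F u = u -> leJ u w -> (ell (F w) <= ell w)%N.
Proof.
move=> fix_u; move: w; apply: leJ_ind => [|y z _ yz le_y]; first by rewrite fix_u.
have [s [sJ def_z lt_yz]] := stepJP _ _ yz.
case: (phi_step yz) => [/stepJP[t [tJ -> _]]|->].
  exact: leq_trans (len_mulS _ (JS tJ)) (leq_ltn_trans le_y lt_yz).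
exact: leq_trans le_y (ltnW lt_yz).
Qed.

(** A Knaster-Tarski argument: an element of maximal length among the [z] with
    [z <= F z] that lie below all fixed points is itself fixed. *)
Lemma least_fixpoint v : leJ v (F v) ->
  exists u, [/\ F u = u, leJ v u & forall x, F x = x -> leJ v x -> leJ u x].
Proof.
move=> vFv.
pose Z z := [&& leJ v z, leJ z (F z)
              & [forall x, (F x == x) && leJ v x ==> leJ z x]].
have Zv : Z v.
  by rewrite /Z vFv /leJ connect0; apply/forall_inP=> x /andP[].
have [u /and3P[vu uFu /forall_inP below_u] max_u] := arg_maxnP ell Zv.
exists u; split=> // [|x Fx vx]; last by apply: below_u; rewrite Fx eqxx.
apply: (leJ_len_eq uFu (max_u _ _)); apply/and3P; split.
- exact: connect_trans vu uFu.
- exact: leJ_phi.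
by apply/forall_inP=> x xP; have/andP[/eqP<- _] := xP; apply/leJ_phi/below_u.
Qed.

Definition good w :=
  F w = w /\ forall s, s \in J -> (ell (s * w) < ell w)%N -> F (s * w) = w.

(** In a coset that [F] maps to itself, the good element is the least fixed
    point of [F].  Below a fixed point [w] that is not the least one there is
    some [s w < w] above the least one; since [F] does not increase lengths
    there, [F (s w)] cannot be [w]. *)
Lemma good_unique v : v \in minrep S J -> leJ v (F v) ->
  exists u, [/\ good u, leJ v u & forall w, good w -> leJ v w -> w = u].
Proof.
move=> vm vFv; have [u [Fu vu min_u]] := least_fixpoint vFv.
exists u; split=> // [|w [Fw good_w] vw].
  split=> // s sJ lt_su; have sS := JS sJ.
  have := phi_meets sS wss sz (y := s * u); rewrite mulSK // Fu => /(_ lt_su).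
  case: ifP => _ => [//|[def_u _]].
  have/min_u: F (s * u) = s * u by rewrite [in RHS]def_u mulSK.
  rewrite minrep_leJ //; last first.
    by rewrite -mulgA groupM ?leJ_coset // mem_gen.
  by move/(_ isT)/leJ_len; rewrite leqNgt lt_su.
have uw := min_u w Fw vw; apply/eqP; apply: contraT => /(leJ_last uw).
case=> s sJ [us lt_s].
by have := len_phi_fix Fu us; rewrite good_w // leqNgt lt_s.
Qed.

End Trajectory.

(** * Transport to minimal coset representatives *)

(** [phi1J] and [phiJ] are the analogues of [phi1] and [phi] for the action
    [dotJ]; they describe the supports of the matrices whose trace is taken. *)
Definition phi1J s (b : bool) v : W :=
  if b then bmax S (dotJ S J v s) v else bmin S (dotJ S J v s) v.

Definition phiJ (ss : seq W) (bs : seq bool) v : W :=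
  foldl (fun x p => phi1J p.1 p.2 x) v (zip ss bs).

(** When [dotJ] fixes [v], both the maximum and the minimum are [v]. *)
Lemma phi1JE s b v : phi1J s b v = if v * s \in minrep S J then phi1 S s b v else v.
Proof.
rewrite /phi1J /phi1 /dotJ; case: (_ \in _) => //.
by rewrite /bmax /bmin /bruhat connect0; case: b.
Qed.

(** If [v s] is not minimal then [v s = t v] with [t] in [J], so that [w s]
    remains in the coset of [v], like [w]. *)
Lemma phi1J_leJ s b v w : s \in S -> v \in minrep S J -> leJ v w ->
  phi1J s b v \in minrep S J /\ leJ (phi1J s b v) (phi1 S s b w).
Proof.
move=> sS vm vw; rewrite phi1JE; case: ifP => [vsm|/negbT vsm].
  split; first by rewrite phi1E //; case: ifP.
  have ws : word [:: s] by rewrite /= sS.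
  exact: (leJ_phi (bs := [:: b]) ws erefl vw).
split=> //; rewrite phi1E //; case: ifP => // _.
have [t tJ def_vs] := minrep_Smul vm sS vsm; apply: minrep_leJ => //.
have -> : w * s * v^-1 = w * v^-1 * t.
  by rewrite -(mulgK v t) def_vs !mulgA mulgKV.
by rewrite groupM ?leJ_coset // mem_gen.
Qed.

(** Minimal coset representatives move under [phiJ] below the elements of their
    cosets moving under [phi]. *)
Lemma phiJ_leJ ss bs v w : word ss -> v \in minrep S J -> leJ v w ->
  phiJ ss bs v \in minrep S J /\ leJ (phiJ ss bs v) (phi S ss bs w).
Proof.
elim: ss bs v w => [|s ss IH] [|b bs] v w //= /andP[sS wss] vm vw.
have [vm' vw'] := phi1J_leJ b sS vm vw.
exact: (IH bs _ _ wss vm' vw').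
Qed.

(** Sending [w] to its coset is a bijection from the elements for which [b] is
    good to the fixed points of [phiJ]: a fixed coset is mapped to itself by
    [phi], hence contains exactly one good element by [good_unique]. *)
Lemma card_Good n (ss : n.-tuple W) (b : n.-tuple bool) : word ss ->
  #|[set w | b \in Good S J ss w]| = #|[set v in minrep S J | phiJ ss b v == v]|.
Proof.
move=> wss; have sz : size b = size ss by rewrite !size_tuple.
have [pr pr_m pr_le] := fin_all_exists2 minrep_exists.
have fix_pr w : phi S ss b w = w -> phiJ ss b (pr w) = pr w.
  move=> fix_w; have [m] := phiJ_leJ b wss (pr_m w) (pr_le w).
  by rewrite fix_w => /(minrep_unique m (pr_m w)); apply.
have fix_le v : v \in minrep S J -> phiJ ss b v = v -> leJ v (phi S ss b v).
  move=> vm fix_v; rewrite -{1}fix_v.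
  by have [] := phiJ_leJ b wss vm (connect0 _ v).
have goodP w : reflect (good ss b w) (w \in [set w | b \in Good S J ss w]).
  by rewrite in_set; apply: Good_merge.
rewrite -(@card_in_imset _ _ pr) => [|w w']; last first.
  move=> /goodP gw /goodP gw' e.
  have [u [_ _ uniq_u]] :=
    good_unique wss sz (pr_m w) (fix_le _ (pr_m w) (fix_pr _ gw.1)).
  by rewrite (uniq_u w) // (uniq_u w') // e.
apply: eq_card => v; rewrite [RHS]inE; apply/imsetP/andP => [[w]|[vm /eqP fix_v]].
  case/goodP=> fix_w _ ->.
  by rewrite pr_m fix_pr.
have [u [gu vu _]] := good_unique wss sz vm (fix_le _ vm fix_v).
exists u; first exact/goodP.
exact: minrep_unique vm (pr_m u) vu (pr_le u).
Qed.

End Parabolic.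

End Words.

(** * The trace on [V_J] *)

Local Open Scope ring_scope.
Import GRing.Theory.

Lemma big_bool_tuple_cons (V : nmodType) n (f : seq bool -> V) :
  \sum_(t : n.+1.-tuple bool) f t = \sum_(a : bool) \sum_(t : n.-tuple bool) f (a :: t).
Proof.
rewrite pair_bigA /=.
rewrite (reindex (fun p : bool * n.-tuple bool => [tuple of p.1 :: p.2])) //=.
exists (fun t => (thead t, behead_tuple t)) => [[a t] _|t _] /=.
  by congr (_, _); apply: val_inj.
by rewrite [RHS]tuple_eta; apply: val_inj.
Qed.

Section Trace.

Variables (R : realType) (W : finGroupType) (S J : {set W}).
Hypotheses (hS : coxeter_system S) (hJ : J \subset S).
Local Notation K := (Kq R).
Local Notation e v := (VJ_basis R S J v).

Lemma VJ_basis_mul m (A : 'M[K]_(#|minrep S J|, m)) i : e (enum_val i) *m A = row i A.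
Proof.
rewrite rowE; congr (_ *m _); apply/rowP=> j.
by rewrite !mxE eqxx (inj_eq enum_val_inj).
Qed.

(** In [w + (q max + min - w)] the two occurrences of [w] cancel: this is why the
    operators [1 + T_s] have an expansion with one term for each bit. *)
Lemma VJ_basis_step s v : v \in minrep S J ->
  e v *m (1%:M + VJ_T R S J s) = \sum_(b : bool) q ^+ b *: e (phi1J S J s b v).
Proof.
move=> vm; rewrite -(enum_rankK_in vm vm) VJ_basis_mul.
move: (enum_rank_in vm v) => i; rewrite linearD /= row1 rowK big_bool /=.
rewrite expr1 expr0 scale1r.
have -> : delta_mx 0 i = e (enum_val i) by rewrite -[RHS]mulmx1 VJ_basis_mul row1.
by rewrite [LHS]addrC addrNK.
Qed.

Lemma VJ_basis_prod ss v : all (mem S) ss -> v \in minrep S J ->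
  e v *m (\prod_(s <- ss) (1%:M + VJ_T R S J s)) =
    \sum_(b : (size ss).-tuple bool) q ^+ (\sum_(a <- b) a)%N *: e (phiJ S J ss b v).
Proof.
elim: ss v => [|s ss IH] v /=.
  move=> _ _; rewrite big_nil mulmx1 (big_pred1 [tuple]) => [|b]; last first.
    by rewrite [b]tuple0 /= eqxx.
  by rewrite big_nil expr0 scale1r.
case/andP=> sS wss vm; rewrite big_cons -mulmxE mulmxA VJ_basis_step //.
rewrite (big_bool_tuple_cons _
  (fun b => q ^+ (\sum_(a <- b) a)%N *: e (phiJ S J (s :: ss) b v))).
rewrite mulmx_suml; apply: eq_bigr => a _.
have [vm' _] := phi1J_leJ hS hJ a sS vm (connect0 _ v).
rewrite -scalemxAl IH // scaler_sumr; apply: eq_bigr => b _.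
by rewrite scalerA -exprD big_cons.
Qed.

Lemma cJ_fixpoints n (ss : n.-tuple W) : all (mem S) ss ->
  cJ R S J ss = \sum_(b : n.-tuple bool)
    q ^+ (\sum_(a <- b) a)%N *+ #|[set v in minrep S J | phiJ S J ss b v == v]|.
Proof.
move=> wss; pose f v := \sum_(b : n.-tuple bool)
  q ^+ (\sum_(a <- b) a)%N *+ (phiJ S J ss b v == v) : K.
transitivity (\sum_(v in minrep S J) f v).
  rewrite big_enum_val; apply: eq_bigr => i _.
  set M := \prod_(s <- ss) _.
  have -> : M i i = (e (enum_val i) *m M) 0 i by rewrite VJ_basis_mul mxE.
  rewrite VJ_basis_prod ?enum_valP // summxE size_tuple; apply: eq_bigr => b _.
  by rewrite !mxE eq_sym mulr_natr.
rewrite exchange_big; apply: eq_bigr => b _.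
rewrite sumrMnr; congr (_ *+ _).
rewrite -sum1_card big_mkcond [RHS]big_mkcond /=.
by apply: eq_bigr => v _; rewrite [in RHS]inE; case: (v \in minrep S J); case: (_ == v).
Qed.

Lemma cJ'_card n (ss : n.-tuple W) :
  cJ' R S J ss = \sum_(b : n.-tuple bool)
    q ^+ (\sum_(a <- b) a)%N *+ #|[set w | b \in Good S J ss w]|.
Proof.
rewrite /cJ' (exchange_big_dep xpredT) //=; apply: eq_bigr => b _.
rewrite sumr_const big_tuple; congr (_ *+ _).
by apply: eq_card => w; rewrite [RHS]in_set.
Qed.

End Trace.

Theorem theorem5p11 (R : realType) (W : finGroupType) (S J : {set W})
    (n : nat) (ss : n.-tuple W)
    (hS : coxeter_system S) (hJ : J \subset S)
    (hss : forall i : 'I_n, tnth ss i \in S) :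
  cJ' R S J ss = cJ R S J ss /\
  (forall (H : algType (Kq R)) (T : W -> H)
     (rho : {linear H -> 'M[Kq R]_#|minrep S J|}),
     hecke_algebra S T -> VJ_module T rho ->
     cJ' R S J ss = \tr (rho (\prod_(s <- ss) (1 + T s)))).
Proof.
have wss : all (mem S) ss by apply/all_tnthP.
have e : cJ' R S J ss = cJ R S J ss.
  rewrite cJ'_card cJ_fixpoints //; apply: eq_bigr => b _.
  by rewrite (card_Good hS hJ).
split=> // H T rho _ [rho1 rhoM rhoT]; rewrite e /cJ; congr (\tr _).
elim: (tval ss) wss => [|s r IH] /=; first by rewrite !big_nil rho1.
case/andP=> sS /IH IHr.
by rewrite !big_cons rhoM -IHr linearD /= rho1 rhoT.
Qed.
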